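(* Consider the system $$\dot x=f(x)+g_1(x)d+g_2(x)u,\qquad x\in\mathbb R^n,\ d\in\mathbb R^{m_1},\ u\in\mathbb R^{m_2},$$ with a nominal control law $u_0=u_0(x,t)$ and a barrier function candidate $h$. Let $\gamma$ be a class $\mathcal K_\infty$ function whose derivative $\gamma'$ is also a class $\mathcal K_\infty$ function, and consider the auxiliary system $$\dot x=f(x)-g_1(x)\,\ell\gamma(2|L_{g_1}h|)\frac{(L_{g_1}h(x))^{T}}{|L_{g_1}h|^2}+g_2(x)u .$$ Suppose that, for the given $u_0$, there exists a matrix-valued function $R_2(x,u_0)=R_2(x,u_0)^T>0$ such that the control law $u=u_0+\bar u(x,u_0):=u_0+R_2(x,u_0)^{-1}(L_{g_2}h)^T$ ensures safety of the auxiliary system with respect to $h$, namely ensures that $$L_{f+g_2u_0}h-\ell\gamma(2|L_{g_1}h|)+L_{g_2}h\,R_2^{-1}(L_{g_2}h)^T\ \ge\ -\alpha(h(x))$$ for some $\alpha\in\mathcal K_h$. Then, for every $\beta\ge 2$, the control law $$u=u_0+\bar u^*(x,u_0):=u_0+\beta\bar u(x,u_0)=u_0+\beta R_2^{-1}(L_{g_2}h)^T$$ applied to $\dot x=f+g_1d+g_2u$ maximizes (over $u-u_0\in\mathcal U$), for any $\lambda\in(0,2]$, the cost functional $$J(u-u_0)=\inf_{d\in\mathcal D}\Big\{\lim_{t\to\infty}\Big[2\beta h(x(t))+\int_0^t\Big(l(x,u_0)-(u-u_0)^TR_2(x,u_0)(u-u_0)+\beta\lambda\,\gamma\Big(\frac{|d|}{\lambda}\Big)\Big)d\tau\Big]\Big\},$$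 where $$l(x,u_0)=-2\beta\Big[L_{f+g_2u_0}h-\ell\gamma(2|L_{g_1}h|)+L_{g_2}h\,R_2^{-1}(L_{g_2}h)^T\Big]-\beta(2-\lambda)\,\ell\gamma(2|L_{g_1}h|)-\beta(\beta-2)\,L_{g_2}h\,R_2^{-1}(L_{g_2}h)^T,$$ and this $l$ satisfies $l(x,u_0)\le 2\beta\,\alpha(h(x))$.
   Context: $f,g_1,g_2$ are locally Lipschitz. A barrier function candidate is a differentiable $h:\mathbb R^n\to\mathbb R$ with $\inf h<0<\sup h$; the safe set is $\mathcal C=\{x: h(x)\ge0\}$, assumed to have no isolated points. Lie derivatives: $L_fh=\frac{\partial h}{\partial x}f$ (scalar), $L_{g_i}h=\frac{\partial h}{\partial x}g_i$ (row vector). $|\cdot|$ is the Euclidean norm. Class $\mathcal K_\infty$: continuous strictly increasing unbounded functions on $[0,\infty)$ vanishing at $0$. For $a<0<b$, class $\mathcal K_{(a,b)}$: continuous strictly increasing functions $(a,b)\to\mathbb R$ vanishing at $0$. $\mathcal K_h:=\mathcal K_{(\inf h,\sup h)}$; it is understood that $\alpha(h(x))$ is defined for all $x$. Legendre–Fenchel transform: $\ell\gamma(r)=\int_0^r(\gamma')^{-1}(s)\,ds$, where $(\gamma')^{-1}$ is the inverse function of $\gamma'$. The vector $\ell\gamma(2|v|)\,v^T/|v|^2$ is read as $0$ when $v=0$. $\mathcal U$ and $\mathcal D$ are sets of locally bounded functions of $x$ (feedback control deviations $u-u_0$ and disturbances $d$; dependence on $t$ through $u_0(x,t)$ is allowed).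 Regularity convention: existence of closed-loop solutions on $[0,\infty)$ and of the limit in $J$ (in the extended reals) for the admissible pairs is taken for granted, and the control law $\bar u^*$ is taken to be in $\mathcal U$. In $J$, $x(\cdot)$ is the solution from a given initial state $x(0)$ under the inputs $u,d$. ''Maximizes'' means $J(u-u_0)\le J(\bar u^* )$ for all $u-u_0\in\mathcal U$.
   Formalization: The formal theorem additionally assumes that the worst-case disturbance d* = -λ(γ')^{-1}(2|L_{g1}h|)(L_{g1}h)^T/|L_{g1}h| belongs to 𝒟; for an arbitrary set 𝒟 (e.g. 𝒟={0}) the maximization claim is false. *)

(* Defs.v *)
From HB Require Import structures.
From mathcomp Require Import all_boot all_order all_algebra.
From mathcomp Require Import all_classical all_reals all_analysis.
From mathcomp Require Import ring.

Set Implicit Arguments.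
Unset Strict Implicit.
Unset Printing Implicit Defensive.
Import Order.TTheory GRing.Theory Num.Theory.
Import numFieldNormedType.Exports.

Local Open Scope classical_set_scope.
Local Open Scope ring_scope.

(* The library norm on matrices is the sup norm; this is the Euclidean one,
   used for both column vectors and row vectors. *)
Definition enorm (R : realType) (m p : nat) (v : 'M[R]_(m, p)) : R :=
  Num.sqrt (\sum_i \sum_j v i j ^+ 2).

Definition qform (R : realType) (m : nat) (M : 'M[R]_m) (v : 'cV[R]_m) : R :=
  (v^T *m M *m v) 0 0.

Definition sym_posdef (R : realType) (m : nat) (M : 'M[R]_m) : Prop :=
  M^T = M /\ forall v : 'cV[R]_m, v != 0 -> 0 < qform M v.

Section comparison_functions.
Context {R : realType}.

(* Class K_infty functions are functions on [0, +oo[; the values of the total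
   function [g] at negative reals are irrelevant. *)
Definition class_Kinfty (g : R -> R) : Prop :=
  [/\ {within `[0, +oo[, continuous g},
      {in `[0, +oo[ &, {homo g : r s / r < s}},
      forall M : R, exists2 r, 0 <= r & M < g r
    & g 0 = 0].

(* [alpha] is total, so [alpha (h x)] also makes sense where [h] attains its
   infimum or supremum; nothing is required of these endpoint values. *)
Definition class_Kab (a b : \bar R) (alpha : R -> R) : Prop :=
  let I := [set r : R | (a < r%:E < b)%E] in
  [/\ {within I, continuous alpha},
      {in I &, {homo alpha : r s / r < s}}
    & alpha 0 = 0].

(* Derivative of a function on [0, +oo[, hence one-sided at 0. *)
Definition is_derivative_nneg (g dg : R -> R) : Prop :=
  forall r, 0 <= r ->
    (fun s => (g s - g r) / (s - r)) @ within `[0, +oo[ r^' --> dg r.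

Definition inverse_nneg (dg : R -> R) : R -> R :=
  'pinv_(fun=> 0) `[0, +oo[ dg.

(* Legendre-Fenchel transform of g, in terms of the derivative dg of g. *)
Definition legendre_fenchel (dg : R -> R) (r : R) : R :=
  \int[lebesgue_measure]_(s in `[0, r]) inverse_nneg dg s.

End comparison_functions.

Section barrier.
Context {R : realType} {n : nat}.
Implicit Types h : 'cV[R]_n -> R.

Definition barrier_candidate h : Prop :=
  (forall x, differentiable h x) /\
  (ereal_inf (range (EFin \o h)) < 0 < ereal_sup (range (EFin \o h)))%E.

Definition safe_set h : set 'cV[R]_n := [set x | 0 <= h x].

Definition class_Kh h : (R -> R) -> Prop :=
  class_Kab (ereal_inf (range (EFin \o h))) (ereal_sup (range (EFin \o h))).

Definition lie h (F : 'cV[R]_n -> 'cV[R]_n) (x : 'cV[R]_n) : R :=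
  'd h x (F x).

Definition lie_mx (m : nat) h (G : 'cV[R]_n -> 'M[R]_(n, m)) (x : 'cV[R]_n) :
    'rV[R]_m :=
  \row_j lie h (fun y => col j (G y)) x.

End barrier.

Section closed_loop.
Context {R : realType} {n : nat}.

Definition locally_bounded_feedback (m : nat)
    (v : 'cV[R]_n -> R -> 'cV[R]_m) : Prop :=
  forall t, 0 <= t -> [locally [bounded v x t | x in setT]].

(* Caratheodory solutions on [0, +oo[: feedbacks are only locally bounded, so
   the differential equation is read in integral form, componentwise. *)
Definition is_solution (F : 'cV[R]_n -> R -> 'cV[R]_n) (x0 : 'cV[R]_n)
    (x : R -> 'cV[R]_n) : Prop :=
  forall t, 0 <= t -> forall i,
    lebesgue_measure.-integrable `[0, t] (fun s => (F (x s) s i 0)%:E) /\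
    x t i 0 = x0 i 0 + \int[lebesgue_measure]_(s in `[0, t]) F (x s) s i 0.

End closed_loop.

Section inverse_optimal.
Context {R : realType} {n m1 m2 : nat}.
Variables (f : 'cV[R]_n -> 'cV[R]_n) (g1 : 'cV[R]_n -> 'M[R]_(n, m1))
  (g2 : 'cV[R]_n -> 'M[R]_(n, m2)) (h : 'cV[R]_n -> R).
Variables (gamma dgamma : R -> R).
Variables (u0 : 'cV[R]_n -> R -> 'cV[R]_m2)
  (R2 : 'cV[R]_n -> 'cV[R]_m2 -> 'M[R]_m2).

Definition system (d : 'cV[R]_n -> R -> 'cV[R]_m1)
    (u : 'cV[R]_n -> R -> 'cV[R]_m2) (x : 'cV[R]_n) (t : R) : 'cV[R]_n :=
  f x + g1 x *m d x t + g2 x *m u x t.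

(* In the functions below, [w] stands for the value u0(x, t). *)

Definition lf_g1 (x : 'cV[R]_n) : R :=
  legendre_fenchel dgamma (2 * enorm (lie_mx h g1 x)).

Definition ubar (x : 'cV[R]_n) (w : 'cV[R]_m2) : 'cV[R]_m2 :=
  invmx (R2 x w) *m (lie_mx h g2 x)^T.

Definition lie_g2_sq (x : 'cV[R]_n) (w : 'cV[R]_m2) : R :=
  qform (invmx (R2 x w)) (lie_mx h g2 x)^T.

(* Division by 0 gives 0, which is the reading of the middle term where
   L_{g1}h vanishes. *)
Definition auxiliary_system (u : 'cV[R]_m2) (x : 'cV[R]_n) : 'cV[R]_n :=
  f x - g1 x *m (lf_g1 x / enorm (lie_mx h g1 x) ^+ 2 *: (lie_mx h g1 x)^T)
  + g2 x *m u.

(* Derivative of h along the auxiliary system under u = w + ubar(x, w);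
   see [aux_rateE]. *)
Definition aux_rate (x : 'cV[R]_n) (w : 'cV[R]_m2) : R :=
  lie h (fun y => f y + g2 y *m w) x - lf_g1 x + lie_g2_sq x w.

Lemma aux_rateE x w :
  lie h (auxiliary_system (w + ubar x w)) x = aux_rate x w.
Proof.
have lieM m (G : 'cV[R]_n -> 'M[R]_(n, m)) (v : 'cV[R]_m) :
    'd h x (G x *m v) = (lie_mx h G x *m v) 0 0.
  have -> : G x *m v = \sum_j v j 0 *: col j (G x).
    apply/colP => i; rewrite mxE summxE.
    by apply: eq_bigr => j _; rewrite !mxE mulrC.
  rewrite linear_sum mxE; apply: eq_bigr => j _.
  by rewrite linearZ /= mxE mulrC.
rewrite /aux_rate /lie /auxiliary_system mulmxDr !linearD linearN /= !lieM.
have -> : (lie_mx h g2 x *m ubar x w) 0 0 = lie_g2_sq x w.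
  by rewrite /ubar /lie_g2_sq /qform trmxK mulmxA.
rewrite -scalemxAr !mxE.
under eq_bigr do rewrite [_^T _ _]mxE -expr2.
have -> : \sum_j lie_mx h g1 x 0 j ^+ 2 = enorm (lie_mx h g1 x) ^+ 2.
  rewrite /enorm big_ord1 sqr_sqrtr //.
  by apply: sumr_ge0 => j _; rewrite sqr_ge0.
set e := enorm _; have [e0|e0] := eqVneq e 0; last first.
  by rewrite divfK ?sqrf_eq0//; ring.
have -> : lf_g1 x = 0.
  by rewrite /lf_g1 -/e e0 mulr0 /legendre_fenchel set_itv1 Rintegral_set1.
by rewrite mul0r mul0r; ring.
Qed.

Definition running_cost (beta lambda : R) (x : 'cV[R]_n) (w : 'cV[R]_m2) : R :=
  - (2 * beta * aux_rate x w) - beta * (2 - lambda) * lf_g1 x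
  - beta * (beta - 2) * lie_g2_sq x w.

(* Controls are represented by the deviation v = u - u0 from u0. *)

Definition integrand (beta lambda : R) (v : 'cV[R]_n -> R -> 'cV[R]_m2)
    (d : 'cV[R]_n -> R -> 'cV[R]_m1) (x : R -> 'cV[R]_n) (s : R) : R :=
  running_cost beta lambda (x s) (u0 (x s) s)
  - qform (R2 (x s) (u0 (x s) s)) (v (x s) s)
  + beta * lambda * gamma (enorm (d (x s) s) / lambda).

Definition cost_upto (beta lambda : R) (v : 'cV[R]_n -> R -> 'cV[R]_m2)
    (d : 'cV[R]_n -> R -> 'cV[R]_m1) (x : R -> 'cV[R]_n) (t : R) : \bar R :=
  (2 * beta * h (x t) +
   \int[lebesgue_measure]_(s in `[0, t]) integrand beta lambda v d x s)%:E.

(* [x] is a closed-loop solution on [0, +oo[ from x0, and the integral and the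
   limit occurring in the cost functional exist (the latter in \bar R). *)
Definition well_posed (beta lambda : R) (x0 : 'cV[R]_n)
    (v : 'cV[R]_n -> R -> 'cV[R]_m2) (d : 'cV[R]_n -> R -> 'cV[R]_m1)
    (x : R -> 'cV[R]_n) : Prop :=
  [/\ is_solution (system d (fun y s => u0 y s + v y s)) x0 x,
      forall t, 0 <= t ->
        lebesgue_measure.-integrable `[0, t]
          (fun s => (integrand beta lambda v d x s)%:E)
    & cvg (cost_upto beta lambda v d x t @[t --> +oo])].

(* [sol v d] is the closed-loop trajectory under the deviation v and the
   disturbance d. *)
Definition cost (beta lambda : R)
    (D : set ('cV[R]_n -> R -> 'cV[R]_m1))
    (sol : ('cV[R]_n -> R -> 'cV[R]_m2) -> ('cV[R]_n -> R -> 'cV[R]_m1) ->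
           R -> 'cV[R]_n)
    (v : 'cV[R]_n -> R -> 'cV[R]_m2) : \bar R :=
  ereal_inf [set lim (cost_upto beta lambda v d (sol v d) t @[t --> +oo])
            | d in D].

Definition optimal_deviation (beta : R) (x : 'cV[R]_n) (t : R) : 'cV[R]_m2 :=
  beta *: ubar x (u0 x t).

(* Minimizer of 2 L_{g1}h d + lambda gamma(|d| / lambda) over d. *)
Definition worst_disturbance (lambda : R) (x : 'cV[R]_n) (t : R) : 'cV[R]_m1 :=
  - (lambda * inverse_nneg dgamma (2 * enorm (lie_mx h g1 x))
     / enorm (lie_mx h g1 x)) *: (lie_mx h g1 x)^T.

End inverse_optimal.

(* Main.v *)
(* Along a trajectory, completing the square in u and using the Young inequality
   a b <= l gamma (a) + gamma (b) give
     2 beta (h o x)' + integrand = beta G - (v - vopt)^T R2 (v - vopt),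
   where vopt is the optimal deviation and G >= 0 vanishes at the worst
   disturbance dmin.  Hence the cost along (v, dmin) is at most 2 beta h(x0),
   and the cost along (vopt, d) is at least 2 beta h(x0).

   The only delicate point is the integration of this inequality: h is merely
   differentiable and x merely absolutely continuous, so h o x need not be
   absolutely continuous.  A one-sided bound (h o x)' <= g, valid at almost
   every t with g integrable, is nevertheless enough: on the exceptional null
   set, h o x is pointwise Lipschitz with respect to the variation of x, which
   is dominated there by a nondecreasing function of arbitrarily small total
   increase. *)

Require Import Defs.
From HB Require Import structures.
From mathcomp Require Import all_boot all_order all_algebra.
From mathcomp Require Import all_classical all_reals all_analysis.
From mathcomp Require Import ring lra.

Set Implicit Arguments.
Unset Strict Implicit.
Unset Printing Implicit Defensive.
Import Order.TTheory GRing.Theory Num.Theory.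
Import numFieldNormedType.Exports.

Local Open Scope classical_set_scope.
Local Open Scope ring_scope.

(** * Majorants of null sets *)

Section null_majorant.
Context {R : realType}.
Notation mu := (@lebesgue_measure R).
Implicit Types (f W : R -> R) (s t : R).

Lemma integrable_restrict f (A : set R) : measurable A ->
  mu.-integrable A (EFin \o f) -> mu.-integrable setT (EFin \o (f \_ A)).
Proof. by move=> mA fi; rewrite -restrict_EFin -integrable_mkcond. Qed.

(** Based at -oo so that it is defined for every [t]. Integrands living on [[0, T]] are first
    extended by zero. *)
Definition primitive f t : R := \int[mu]_(x in `]-oo, t]) f x.

Lemma primitiveB f s t : mu.-integrable setT (EFin \o f) -> t <= s ->
  primitive f s - primitive f t = \int[mu]_(x in `]t, s]) f x.
Proof.
move=> fi ts; rewrite /primitive Rintegral_itvB ?bnd_simp//.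
exact: integrableS fi.
Qed.

Lemma primitive_ge0 f t : (forall x, 0 <= f x) -> 0 <= primitive f t.
Proof. by move=> f0; apply: Rintegral_ge0. Qed.

Lemma primitive_le f s t : mu.-integrable setT (EFin \o f) ->
  (forall x, 0 <= f x) -> t <= s -> primitive f t <= primitive f s.
Proof.
by move=> fi f0 ts; rewrite -subr_ge0 primitiveB//; exact: Rintegral_ge0.
Qed.

Lemma primitiveB_norm f W s t : mu.-integrable setT (EFin \o f) ->
  mu.-integrable setT (EFin \o W) -> (forall x, `|f x| <= W x) -> t <= s ->
  `|primitive f s - primitive f t| <= primitive W s - primitive W t.
Proof.
move=> fi Wi fW ts; rewrite !primitiveB//.
apply: (le_trans (le_normr_Rintegral _ _)) => //; first exact: integrableS fi.
apply: le_Rintegral => //; last exact: integrableS Wi.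
have -> : EFin \o (fun x => `|f x|) = abse \o (EFin \o f) by [].
by apply: integrable_abse; exact: integrableS fi.
Qed.

Lemma primitive_restrict_le f (A : set R) t : measurable A ->
  mu.-integrable setT (EFin \o f) -> (forall x, 0 <= f x) ->
  primitive (f \_ A) t <= \int[mu]_(x in A) f x.
Proof.
move=> mA fi f0; rewrite /primitive [leRHS]Rintegral_mkcond.
have fAi : mu.-integrable setT (EFin \o (f \_ A)).
  by apply: integrable_restrict => //; exact: integrableS fi.
rewrite Rintegral_mkcond; apply: le_Rintegral => //.
  by apply: integrable_restrict => //; exact: integrableS fAi.
by move=> x _; rewrite !patchE; case: ifP => //; case: ifP.
Qed.

(* Replaces the primitive of an integrable lower semicontinuous function which
   is infinite on N: its difference quotients beat those of [primitive W]. *)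
Lemma null_majorant (N : set R) W (e : R) : mu.-negligible N -> 0 < e ->
  mu.-integrable setT (EFin \o W) -> (forall x, 0 <= W x) ->
  exists A : R -> R,
    [/\ forall s t, t <= s -> A t <= A s,
        forall t, 0 <= A t <= e &
        forall t K, N t -> \forall s \near t^'+,
          K * (primitive W s - primitive W t) <= A s - A t].
Proof.
move=> [M [mM M0 NM]] e0 Wi W0.
(* In the bound on the integral of [W] over [U k], the factor [k.+1] pays for the weight in [a k],
   and [2 ^ k.+1] makes the weighted bounds sum to [e]. Outer regularity and absolute continuity of
   the integral provide such open sets. *)
have en (k : nat) : 0 < e / (2 ^ k.+1)%:R / k.+1%:R :> R.
  by rewrite !divr_gt0// ltr0n expn_gt0.
suff /choice[U HU] : forall k, exists V : set R, [/\ open V, M `<=` V &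
    \int[mu]_(x in V) W x <= e / (2 ^ k.+1)%:R / k.+1%:R]; last first.
  move=> k; have [d [d0 Hd]] := integral_normr_continuous Wi (en k).
  have [|V [oV MV VMd]] := lebesgue_regularity_outer mM _ d0.
    by rewrite [X in (X < _)%E](M0 : mu M = 0%E) ltry.
  exists V; split => //; apply: le_trans (ltW (Hd V _ _)).
  - rewrite le_eqVlt; apply/orP; left.
    by apply/eqP/eq_Rintegral => x _; rewrite ger0_norm.
  - exact: measurable_realfun.open_measurable.
  - have mV : measurable V by exact: measurable_realfun.open_measurable.
    rewrite -(setDUK MV) measureU//; last by rewrite setDIK.
      by rewrite [X in (X + _)%E](M0 : mu M = 0%E) add0e.
    exact: measurableD.
have oU k : open (U k) by case: (HU k).
have mU k : measurable (U k) by exact: measurable_realfun.open_measurable.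
have MU k : M `<=` U k by case: (HU k).
pose f k := (W \_ (U k) : R -> R).
have fi k : mu.-integrable setT (EFin \o f k).
  by apply: integrable_restrict; [|apply: integrableS Wi]; try exact: mU.
have f0 k x : 0 <= f k x by rewrite /f patchE; case: ifP.
(* Near a point of [N], [a k] grows [k.+1] times as fast as [primitive W]. Summing over [k] thus
   beats every factor [K]. *)
pose a k t := k.+1%:R * primitive (f k) t.
have a0 k t : 0 <= a k t by rewrite mulr_ge0// primitive_ge0.
have ale k t : a k t <= e / (2 ^ k.+1)%:R.
  rewrite /a mulrC -ler_pdivlMr//.
  by apply: le_trans (primitive_restrict_le _ _ _ _) _ => //; case: (HU k).
have amono k s t : t <= s -> a k t <= a k s.
  by move=> ts; rewrite ler_wpM2l// primitive_le.
pose S t := (\sum_(k <oo) (a k t)%:E)%E.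
have S0 t : (0 <= S t)%E by apply: nneseries_ge0 => n _ _; rewrite lee_fin.
have Sle t : (S t <= e%:E)%E.
  apply: le_trans (epsilon_trick0 xpredT (ltW e0)).
  by apply: lee_nneseries => [i _ _|i _]; rewrite lee_fin.
have Sfin t : S t \is a fin_num.
  by rewrite ge0_fin_numE// (le_lt_trans (Sle t))// ltry.
(* The increment of the sum dominates that of each single term, because all terms are
   nondecreasing. *)
have SB k s t : t <= s -> (S t + (a k s - a k t)%:E <= S s)%E.
  move=> ts.
  have -> : S s = (S t + \sum_(k <oo) (a k s - a k t)%:E)%E.
    rewrite -nneseriesD.
    - by apply: eq_eseriesr => i _; rewrite -EFinD addrC subrK.
    - by move=> i _ _; rewrite lee_fin.
    - by move=> i _ _; rewrite lee_fin subr_ge0 amono.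
  rewrite leeD2l// (@nneseriesD1 _ _ k)//.
    by rewrite leeDl// nneseries_ge0// => i _ _; rewrite lee_fin subr_ge0 amono.
  by move=> i _; rewrite lee_fin subr_ge0 amono.
have SE t : (fine (S t))%:E = S t by rewrite fineK.
exists (fun t => fine (S t)); split.
- move=> s t ts; rewrite -lee_fin !SE; apply: le_trans (SB 0%N _ _ ts).
  by rewrite leeDl// lee_fin subr_ge0 amono.
- by move=> t; rewrite -!lee_fin SE S0 Sle.
- move=> t K Nt.
  have [k Kk] : exists k : nat, K <= k.+1%:R.
    exists (Num.truncn `|K|); rewrite (le_trans (ler_norm _))// ltW//.
    by rewrite truncnS_gt.
  have /open_nbhs_nbhs/nbhs_ballP[r /= r0 rU] : open_nbhs t (U k).
    by split => //; apply: MU; exact: NM.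
  near=> s.
  have ts : t < s by near: s; exact: nbhs_right_gt.
  have str : s < t + r by near: s; apply: nbhs_right_lt; lra.
  rewrite lerBrDl -lee_fin SE EFinD SE; apply: le_trans (SB k _ _ (ltW ts)).
  rewrite leeD2l// lee_fin /a -mulrBr.
  have -> : primitive (f k) s - primitive (f k) t =
      primitive W s - primitive W t.
    rewrite !primitiveB ?ltW//; apply: eq_Rintegral => x.
    rewrite inE/= in_itv/= => /andP[tx xs]; rewrite /f patchE mem_set//.
    apply: rU.
    by rewrite /ball/= ltr_norml; apply/andP; split; lra.
  by rewrite ler_wpM2r// subr_ge0 primitive_le// ltW.
Unshelve. all: by end_near. Qed.

End null_majorant.

(** Real induction on the points where [Psi] is at most [Psi 0]. The left condition only forbids
    upward jumps, so a nondecreasing, possibly discontinuous function may be subtracted from a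
    continuous one. *)
Lemma right_nonincreasing_le (R : realType) (Psi : R -> R) (T : R) : 0 <= T ->
  (forall t, 0 <= t < T -> \forall s \near t^'+, Psi s <= Psi t) ->
  (forall t e, 0 < t <= T -> 0 < e ->
     \forall s \near t^'-, Psi t <= Psi s + e) ->
  Psi T <= Psi 0.
Proof.
move=> T0 Pr Pl; pose S := [set t | 0 <= t <= T /\ Psi t <= Psi 0].
have S0 : S 0 by rewrite /S/= lexx T0.
have ST : ubound S T by move=> t [/andP[]].
have supS : has_sup S by split; [exists 0|exists T].
set m := sup S.
have m0 : 0 <= m by apply: ub_le_sup => //; exists T.
have mT : m <= T by apply: ge_sup => //; exists 0.
(* The supremum is attained: members of [S] approach it from the left. *)
have Pm : Psi m <= Psi 0.
  move: m0; rewrite le_eqVlt => /predU1P[<-//|m0].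
  apply/ler_addgt0Pr => e e0.
  have [|r /= r0 rP] := Pl m e _ e0; first by rewrite m0.
  have [s [/andP[s0 sT] Ps] ms] := sup_adherent r0 supS.
  have sm : s <= m.
    by apply: ub_le_sup; [exists T|split => //; apply/andP; split].
  move: sm; rewrite le_eqVlt => /predU1P[<-|sm].
    by rewrite (le_trans Ps)// lerDl ltW.
  apply: le_trans (rP s _ sm) _; last by rewrite lerD2r.
  by rewrite /ball/= ger0_norm; rewrite /m in ms sm *; lra.
(* If [m < T], the right condition would produce members of [S] beyond its supremum. *)
suff -> : T = m by [].
apply/eqP; rewrite eq_le mT andbT leNgt; apply/negP => mltT.
have : \forall s \near m^'+, m < s /\ Psi s <= Psi m.
  near=> s; split; first by near: s; exact: nbhs_right_gt.
  by near: s; apply: Pr; rewrite m0.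
move=> Pn; have : \forall s \near m^'+, False.
  near=> s.
  have [ms Ps] : m < s /\ Psi s <= Psi m by near: s.
  have sT : s <= T by near: s; exact: nbhs_right_le.
  suff : s <= m by rewrite leNgt ms.
  apply: ub_le_sup; first by exists T.
  by split; [rewrite sT andbT (le_trans m0)// ltW|exact: le_trans Pm].
by case/filter_ex.
Unshelve. all: by end_near. Qed.

(** * A chain rule inequality along absolutely continuous curves *)

Section chain_rule_inequality.
Context {R : realType}.
Notation mu := (@lebesgue_measure R).

(** The differential has some Lipschitz constant, and the little-o remainder is eventually at most
    [|y - x|], which adds 1 to it. *)
Lemma differentiable_lipschitz_at (V W : normedModType R) (h : V -> W) (x : V) :
  differentiable h x ->
  exists2 k, 0 < k & \forall y \near x, `|h y - h x| <= k * `|y - x|.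
Proof.
move=> dh; have [k k0 kP] := linear_lipschitz (diff_continuous dh).
exists (k + 1); first by rewrite addr_gt0.
have /eqaddoP/(_ _ ltr01) := diff_locally dh.
set P := (X in \forall z \near _, X z) => oh.
have {}oh : \forall z \near x, P (z - x).
  by move: (oh : \forall z \near 0, P z); rewrite (near_shift x)/= sub0r.
near=> y.
have : P (y - x) by near: y.
rewrite /P !fctE mul1r (_ : shift x (y - x) = y) => [hy|]; last exact: subrK.
rewrite mulrDl mul1r.
have -> : h y - h x = 'd h x (y - x) + (h y - (h x + 'd h x (y - x))).
  by rewrite [RHS]addrC opprD -!addrA addNr addr0.
by rewrite (le_trans (ler_normD _ _))// lerD.
Unshelve. all: by end_near. Qed.

Lemma primitive_continuous (f : R -> R) : mu.-integrable setT (EFin \o f) ->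
  continuous (primitive f).
Proof.
move=> fi t; apply/cvgrPdist_lt => e e0.
have [d [d0 dP]] := integral_normr_continuous fi e0.
have key s r : r <= s -> s - r < d -> `|primitive f s - primitive f r| < e.
  move=> rs sr; rewrite primitiveB//.
  apply: le_lt_trans (le_normr_Rintegral _ _) _ => //.
    exact: integrableS fi.
  apply: dP => //; rewrite [X in (X < _)%E](lebesgue_measure_itv `]r, s])/=.
  by rewrite lte_fin; case: ifPn => // _; rewrite lte_fin.
near=> s.
have : `|t - s| < d by near: s; exists d.
have [ts|st] := leP t s.
  by rewrite distrC ger0_norm ?subr_ge0// => ?; rewrite distrC; apply: key.
by rewrite gtr0_norm ?subr_gt0// => ?; apply: key => //; exact: ltW.
Unshelve. all: by end_near. Qed.

End chain_rule_inequality.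

Section chain_rule_le.
Context {R : realType}.
Notation mu := (@lebesgue_measure R).

Lemma chain_rule_primitive_le n (h : 'cV[R]_n -> R) (F X : R -> 'cV[R]_n)
    (x0 : 'cV[R]_n) (g : R -> R) (T : R) :
  (forall x, differentiable h x) -> 0 <= T ->
  (forall i, mu.-integrable setT (EFin \o (fun t => F t i 0))) ->
  mu.-integrable setT (EFin \o g) ->
  (forall t i, X t i 0 = x0 i 0 + primitive (fun s => F s i 0) t) ->
  (forall t, 0 <= t < T -> 'd h (X t) (F t) <= g t) ->
  h (X T) - h (X 0) <= primitive g T - primitive g 0.
Proof.
move=> dh T0 Fi gi XE hg.
(* One density that controls both the variation of [X] in the sup norm and that of [primitive g]. *)
pose W t := \sum_i `|F t i 0| + `|g t|.
have Wi : mu.-integrable setT (EFin \o W).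
  have -> : EFin \o W = (fun t => (\sum_i `|(F t i 0)%:E| + `|(g t)%:E|)%E).
    by apply/funext => t /=; rewrite EFinD -sumEFin.
  apply: integrableD => //; last exact: (integrable_abse gi).
  by apply: integrable_sum => //= i _; exact: (integrable_abse (Fi i)).
have W0 t : 0 <= W t by rewrite addr_ge0// sumr_ge0.
have FW i t : `|F t i 0| <= W t.
  by rewrite /W (bigD1 i)//= -addrA lerDl addr_ge0// sumr_ge0.
have gW t : `|g t| <= W t by rewrite lerDr sumr_ge0.
have XW s t : t <= s -> `|X s - X t| <= primitive W s - primitive W t.
  move=> ts; rewrite [leLHS]/Num.Def.normr/= mx_normrE.
  apply: bigmax_le; first by rewrite subr_ge0 primitive_le.
  move=> [i j] _ /=; rewrite !mxE ord1 !XE opprD addrACA subrr add0r.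
  exact: primitiveB_norm.
have cg : continuous (primitive g) by exact: primitive_continuous.
have cW : continuous (primitive W) by exact: primitive_continuous.
have cX : continuous X.
  move=> t; apply/cvgrPdist_lt => e e0.
  have /cvgrPdist_lt/(_ e e0) := cW t.
  apply: filterS => s /=.
  have [ts|/ltW st] := leP t s.
    rewrite distrC [in X in _ -> X]distrC => /ltr_normlW.
    by apply: le_lt_trans; exact: XW.
  by move=> /ltr_normlW; apply: le_lt_trans; exact: XW.
have hXc : continuous (h \o X).
  move=> t; apply: continuous_comp; first exact: cX.
  exact: differentiable_continuous.
pose psi t := h (X t) - primitive g t.
have cpsi : continuous psi.
  by move=> t; apply: cvgB; [exact: hXc|exact: cg].
(* By Lebesgue differentiation almost every [t] is good. There the ordinary chain rule applies, and
   [psi] has derivative at most 0. *)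
pose good t := (forall i, derivable (primitive (fun s => F s i 0)) t 1 /\
    'D_1 (primitive (fun s => F s i 0)) t = F t i 0) /\
  (derivable (primitive g) t 1 /\ 'D_1 (primitive g) t = g t).
have aeF : Filter (almost_everywhere mu) := ae_filter_ringOfSetsType mu.
have prim_ae f : mu.-integrable setT (EFin \o f) ->
    {ae mu, forall t, derivable (primitive f) t 1 /\
      'D_1 (primitive f) t = f t}.
  move=> fi; have : {ae mu, forall t, derivable (primitive f) t 1 /\
      derive1 (primitive f) t = f t}.
    apply: FTC1Ny; first by move=> y; exact: integrableS fi.
    exact: open_integrable_locally openT fi.
  by apply: filterS => t; rewrite derive1E.
have good_ae : {ae mu, forall t, good t}.
  have Fae : {ae mu, forall t i, derivable (primitive (fun s => F s i 0)) t 1 /\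
      'D_1 (primitive (fun s => F s i 0)) t = F t i 0}.
    by apply: filter_forall => i; exact: prim_ae.
  by apply: filterS2 Fae (prim_ae _ gi) => t; split.
have right_good t e : 0 <= t < T -> good t -> 0 < e ->
    \forall s \near t^'+, psi s - psi t <= e * (s - t).
  move=> tT [tF [tg tg']] e0.
  have dX : derivable X t 1.
    apply/derivable_mxP => i j; rewrite ord1.
    have -> : (fun s => X s i 0) = cst (x0 i 0) + primitive (fun s => F s i 0).
      by apply/funext => s; rewrite XE.
    by apply: derivableD => //; case: (tF i).
  have DX : 'D_1 X t = F t.
    apply/matrixP => i j; rewrite derive_mx// mxE ord1.
    have -> : (fun s => X s i 0) = cst (x0 i 0) + primitive (fun s => F s i 0).
      by apply/funext => s; rewrite XE.
    have [di <-] := tF i; by rewrite deriveD// derive_cst add0r.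
  have dX' : differentiable X t by exact/derivable1_diffP.
  have dhX : differentiable (h \o X) t by exact: differentiable_comp.
  have dpsi : derivable psi t 1.
    by apply: derivableB => //; exact/derivable1_diffP.
  have Dpsi : 'D_1 psi t <= 0.
    rewrite (_ : psi = (h \o X) - primitive g)//.
    rewrite deriveB//; last exact/derivable1_diffP.
    have := hg t tT; rewrite -DX deriveE// => hgt.
    rewrite [X in X - _]deriveE// diff_comp//= tg' subr_le0.
    exact: hgt.
  have /cvgrPdist_le/(_ e e0) :
      (fun k => k^-1 *: (psi (k *: 1 + t) - psi t)) @ 0^' --> 'D_1 psi t.
    exact: dpsi.
  move=> [r /= r0 rP]; exists r => //= s str ts.
  have := rP (s - t).
  rewrite /= sub0r normrN -normrN opprB.
  move=> /(_ str); rewrite gt_eqF ?subr_gt0// => /(_ isT).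
  rewrite [_%:A]mulr1 subrK distrC => /ler_normlW.
  rewrite lerBlDl => /le_trans/(_ (lerD Dpsi (lexx e))).
  by rewrite add0r /GRing.scale/= mulrC ler_pdivrMr ?subr_gt0.
suff psiT : psi T <= psi 0 by move: psiT; rewrite /psi; lra.
apply/ler_addgt0Pr => e e0.
have T1 : 0 < 1 + T by rewrite ltr_pwDl.
(* [c] bounds the majorant [A] and is also the slope of the linear correction, so the total loss on
   [[0, T]] is at most [c + c * T = e]. *)
pose c := e / (1 + T).
have c0 : 0 < c by rewrite divr_gt0.
have [A [Amono Ae AW]] := null_majorant good_ae c0 Wi W0.
pose Psi t := psi t - A t - c * t.
have PsiT : Psi T <= Psi 0.
  apply: right_nonincreasing_le => //.
  - move=> t tT; have [gt|ngt] := pselect (good t).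
      near=> s.
      have ts : t < s by near: s; exact: nbhs_right_gt.
      have : psi s - psi t <= c * (s - t) by near: s; exact: right_good.
      by have := Amono _ _ (ltW ts); rewrite /Psi; nra.
    (* At an exceptional point, [psi] grows at most [k + 1] times as fast as [primitive W]: [k] for
       [h] along [X] and 1 for [primitive g]. [A] absorbs this. *)
    have [k k0 kP] := differentiable_lipschitz_at (dh (X t)).
    near=> s.
    have ts : t < s by near: s; exact: nbhs_right_gt.
    have AWs : (k + 1) * (primitive W s - primitive W t) <= A s - A t.
      by near: s; exact: AW.
    have hs : `|h (X s) - h (X t)| <= k * `|X s - X t|.
      by near: s; apply: cvg_at_right_filter (cX t) _ kP.
    have gs : `|primitive g s - primitive g t| <= primitive W s - primitive W t.
      by apply: primitiveB_norm => //; exact: ltW.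
    have : k * `|X s - X t| <= k * (primitive W s - primitive W t).
      by rewrite ler_wpM2l ?(ltW k0)// XW// ltW.
    have := ler_normlW hs.
    have : - (primitive g s - primitive g t) <= primitive W s - primitive W t.
      by rewrite ler_normlW// normrN.
    have : 0 <= c * (s - t) by rewrite mulr_ge0 ?(ltW c0)// subr_ge0 ltW.
    rewrite /Psi /psi; nra.
  - move=> t d /andP[t0 tT] d0.
    near=> s.
    have st : s < t by near: s; exact: nbhs_left_lt.
    have : psi t - psi s <= d.
      apply: ler_normlW; near: s.
      have /cvgrPdist_le/(_ _ d0) := cpsi t.
      by apply: cvg_at_left_filter.
    have := Amono _ _ (ltW st).
    have : 0 <= c * (t - s) by rewrite mulr_ge0 ?(ltW c0)// subr_ge0 ltW.
    rewrite /Psi; lra.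
have /andP[_ AT] := Ae T; have /andP[A0 _] := Ae 0.
have ec : e = c + c * T by rewrite /c; field; rewrite gt_eqF.
rewrite ec; move: PsiT; rewrite /Psi; lra.
Unshelve. all: by end_near. Qed.

End chain_rule_le.

(** * Integral inequalities along Caratheodory solutions *)

Section solution.
Context {R : realType}.
Notation mu := (@lebesgue_measure R).

Lemma primitive_restrict_itv (f : R -> R) (T t : R) : 0 <= t <= T ->
  primitive (f \_ `[0, T]) t = \int[mu]_(s in `[0, t]) f s.
Proof.
move=> /andP[t0 tT]; rewrite /primitive -Rintegral_mkcondr; congr Rintegral.
apply/seteqP; split => s /=; rewrite !in_itv/=.
  by move=> [st /andP[s0 _]]; rewrite s0.
by move=> /andP[s0 st]; rewrite st s0 (le_trans st).
Qed.

Lemma solution_init n (F : 'cV[R]_n -> R -> 'cV[R]_n) x0 x :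
  is_solution F x0 x -> x 0 = x0.
Proof.
move=> sol; apply/colP => i; have [_ ->] := sol 0 (lexx 0) i.
by rewrite set_itv1 Rintegral_set1 addr0.
Qed.

(** Extending the velocity and [g] by zero outside [[0, T]] gives a globally defined curve [X] that
    agrees with [x] on [[0, T]], to which the inequality for primitives applies. *)
Lemma solution_le n (h : 'cV[R]_n -> R) (F : 'cV[R]_n -> R -> 'cV[R]_n)
    (x0 : 'cV[R]_n) (x : R -> 'cV[R]_n) (g : R -> R) (T : R) :
  (forall y, differentiable h y) -> is_solution F x0 x -> 0 <= T ->
  mu.-integrable `[0, T] (EFin \o g) ->
  (forall t, 0 <= t -> 'd h (x t) (F (x t) t) <= g t) ->
  h (x T) <= h x0 + \int[mu]_(s in `[0, T]) g s.
Proof.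
move=> dh sol T0 gi hg.
pose G t : 'cV[R]_n := \col_i ((fun s => F (x s) s i 0) \_ `[0, T]) t.
have GE i : (fun t => G t i 0) = (fun s => F (x s) s i 0) \_ `[0, T].
  by apply/funext => t; rewrite mxE.
pose X t := \col_i (x0 i 0 + primitive (fun s => G s i 0) t).
have Xx t : 0 <= t <= T -> X t = x t.
  move=> tT; apply/colP => i; rewrite mxE GE primitive_restrict_itv//.
  by case/andP: tT => t0 _; have [_ ->] := sol t t0 i.
have /= := @chain_rule_primitive_le _ _ h G X x0 (g \_ `[0, T]) T.
rewrite !Xx ?lexx ?T0// (solution_init sol) !primitive_restrict_itv ?lexx ?T0//.
rewrite set_itv1 Rintegral_set1 subr0 lerBlDl; apply => //.
- move=> i; rewrite GE; apply: integrable_restrict => //.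
  by have [] := sol T T0 i.
- exact: integrable_restrict.
- by move=> t i; rewrite mxE.
- move=> t /andP[t0 /ltW tT]; rewrite Xx ?t0// patchE mem_set/= ?in_itv/= ?t0//.
  have -> : G t = F (x t) t.
    by apply/colP => i; rewrite mxE patchE mem_set//= in_itv/= t0.
  exact: hg.
Qed.

End solution.

(** * The Legendre-Fenchel transform *)

Section legendre_fenchel.
Context {R : realType}.
Variables (gamma dgamma : R -> R).
Hypotheses (gamma_K : class_Kinfty gamma)
  (gamma_dgamma : is_derivative_nneg gamma dgamma)
  (dgamma_K : class_Kinfty dgamma).
Local Notation p := (inverse_nneg dgamma).

Lemma class_Kinfty_inj (f : R -> R) : class_Kinfty f ->
  {in `[0, +oo[%classic &, injective f}.
Proof.
move=> [_ fm _ _] x y; rewrite !inE /= => x0 y0 fxy.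
by case: (ltgtP x y) => // /fm; rewrite x0 y0 fxy ltxx => /(_ isT isT).
Qed.

Lemma class_Kinfty_within (f : R -> R) (a b : R) : class_Kinfty f -> 0 <= a ->
  {within `[a, b], continuous f}.
Proof.
move=> [fc _ _ _] a0; apply: continuous_subspaceW fc => x /=.
by rewrite !in_itv/= andbT => /andP[/(le_trans a0)].
Qed.

Lemma class_Kinfty_mono (f : R -> R) : class_Kinfty f ->
  {in >= 0 &, {mono f : x y / x <= y}}.
Proof.
move=> [_ fm _ _]; apply: le_mono_in => x y x0 y0.
by apply: fm; rewrite in_itv/= andbT; [exact: x0|exact: y0].
Qed.

Lemma class_Kinfty_surj (f : R -> R) (a : R) : class_Kinfty f -> 0 <= a ->
  (f @` `[0, +oo[) a.
Proof.
move=> fK a0; have [_ fm funb f0] := fK.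
have [r r0 ar] := funb a.
have [|c] := @IVT _ f 0 r a r0 (class_Kinfty_within fK (lexx 0)).
  by rewrite f0 ge_min a0 le_max (ltW ar) orbT.
by rewrite in_itv/= => /andP[c0 _] <-; exists c => //=; rewrite in_itv/= c0.
Qed.

Lemma inverse_nnegK a : 0 <= a -> dgamma (p a) = a.
Proof.
by move=> a0; rewrite /inverse_nneg pinvK// inE; exact: class_Kinfty_surj.
Qed.

Lemma inverse_nneg_can a : 0 <= a -> p (dgamma a) = a.
Proof.
move=> a0; rewrite /inverse_nneg pinvKV//; first exact: class_Kinfty_inj.
by rewrite inE/= in_itv/= a0.
Qed.

Lemma inverse_nneg_ge0 a : 0 <= a -> 0 <= p a.
Proof.
move=> /(class_Kinfty_surj dgamma_K)[b /=]; rewrite in_itv/= andbT => b0 <-.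
by rewrite inverse_nneg_can.
Qed.

Lemma inverse_nneg0 : p 0 = 0.
Proof.
by have [_ _ _ d0] := dgamma_K; rewrite -[X in p X]d0 inverse_nneg_can.
Qed.

Lemma inverse_nneg_le a b : 0 <= a -> 0 <= b -> (p a <= p b) = (a <= b).
Proof.
move=> a0 b0; rewrite -[in RHS](inverse_nnegK a0) -[in RHS](inverse_nnegK b0).
rewrite (class_Kinfty_mono dgamma_K)//; exact: inverse_nneg_ge0.
Qed.

(** [p] inverts the continuous function [dgamma] on the segment from 0 to [p a], and such an inverse
    is continuous. *)
Lemma inverse_nneg_within a : 0 <= a -> {within `[0, a], continuous p}.
Proof.
move=> a0; have [_ _ _ d0] := dgamma_K.
have := @segment_can_le_continuous _ 0 (p a) dgamma p (inverse_nneg_ge0 a0).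
rewrite d0 inverse_nnegK//; apply; first exact: class_Kinfty_within.
by move=> x; rewrite in_itv/= => /andP[x0 _]; exact: inverse_nneg_can.
Qed.

Lemma is_derive_nneg (r : R) : 0 < r -> is_derive r 1 gamma (dgamma r).
Proof.
move=> r0; suff H :
    (fun k => k^-1 *: (gamma (k *: 1 + r) - gamma r)) @ 0^' --> dgamma r.
  by split; [apply/cvg_ex; exists (dgamma r)|apply/cvg_lim].
apply/cvgrPdist_le => e e0.
have /cvgrPdist_le/(_ e e0) [d /= d0 dP] := gamma_dgamma (ltW r0).
near=> k.
have k0 : k != 0 by near: k; exact: nbhs_dnbhs_neq.
have kd : `|k| < d by near: k; exact: dnbhs0_lt.
(* This keeps [k + r] in [[0, +oo[], so the one-sided derivative is two-sided at [r > 0]. *)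
have kr : `|k| < r by near: k; exact: dnbhs0_lt.
rewrite [_%:A]mulr1 /GRing.scale/= mulrC -[X in _ / X](addrK r).
apply: dP.
- by rewrite /= opprD addrCA subrr addr0 normrN.
- by rewrite -subr_eq0 addrK.
- by rewrite /= in_itv/= andbT; move: kr; rewrite ltr_norml => /andP[]; lra.
Unshelve. all: by end_near. Qed.

(** Mean value theorem between [b] and [c], with [dgamma] increasing. Either point may be 0, since
    the derivative is taken only in the interior. *)
Lemma gamma_convex b c : 0 <= b -> 0 <= c ->
  (b - c) * dgamma c <= gamma b - gamma c.
Proof.
have mvt x y : 0 <= x -> x < y -> exists2 z, x < z < y &
    gamma y - gamma x = dgamma z * (y - x).
  move=> x0 xy; have [||z] := @MVT _ gamma dgamma x y xy.
  - move=> z; rewrite in_itv/= => /andP[xz _]; apply: is_derive_nneg.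
    exact: le_lt_trans xz.
  - exact: class_Kinfty_within.
  by rewrite in_itv/= => zxy ->; exists z.
move=> b0 c0; have [bc|cb|->] := ltgtP b c; last by rewrite !subrr mul0r.
- have [z /andP[bz zc] E] := mvt _ _ b0 bc.
  have : dgamma z <= dgamma c.
    rewrite (class_Kinfty_mono dgamma_K) ?ltW//; exact/ltW/(le_lt_trans b0).
  by nra.
- have [z /andP[cz zb] E] := mvt _ _ c0 cb.
  have : dgamma c <= dgamma z.
    rewrite (class_Kinfty_mono dgamma_K) ?ltW//; exact/ltW/(le_lt_trans c0).
  by nra.
Qed.

(* The maximum over b >= 0 of a * b - gamma b, attained at b = p a, so that
   D' = p although p need not be differentiable. *)
Let D a := a * p a - gamma (p a).

(** Tangent inequality for [gamma] at [p a], where its slope is [a]. *)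
Let D_young a b : 0 <= a -> 0 <= b -> a * b <= D a + gamma b.
Proof.
move=> a0 b0; have := gamma_convex b0 (inverse_nneg_ge0 a0).
by rewrite inverse_nnegK// /D; nra.
Qed.

(** [p a] is a subgradient of [D] at [a]: the Young inequality for [b] against [p a]. *)
Let D_ge a b : 0 <= a -> 0 <= b -> (b - a) * p a <= D b - D a.
Proof.
move=> a0 b0; have := D_young b0 (inverse_nneg_ge0 a0); rewrite [D a]/D; lra.
Qed.

Let D_lip a x y : 0 <= x <= a -> 0 <= y <= a -> `|D x - D y| <= p a * `|x - y|.
Proof.
move=> /andP[x0 xa] /andP[y0 ya].
have := D_ge x0 y0; have := D_ge y0 x0.
have px0 := inverse_nneg_ge0 x0; have py0 := inverse_nneg_ge0 y0.
have a0 := le_trans x0 xa.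
have pxa : p x <= p a by rewrite inverse_nneg_le.
have pya : p y <= p a by rewrite inverse_nneg_le.
have [xy|/ltW yx] := leP x y.
- rewrite (distrC x) [`|y - x|]ger0_norm ?subr_ge0// distrC => *.
  by rewrite ger0_norm; nra.
- rewrite [`|x - y|]ger0_norm ?subr_ge0// => *.
  by rewrite ger0_norm; nra.
Qed.

(** The subgradient inequalities at [a] and [a + k] squeeze the difference quotient between [p a]
    and [p (a + k)], and [p] is continuous at [a]. *)
Let D_derive (a : R) : 0 < a -> is_derive a 1 D (p a).
Proof.
move=> a0; suff H : (fun k => k^-1 *: (D (k *: 1 + a) - D a)) @ 0^' --> p a.
  by split; [apply/cvg_ex; exists (p a)|apply/cvg_lim].
have pc : {for a, continuous p}.
  have a2 : 0 < 2 * a by lra.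
  apply: (within_continuous_continuous a2); first exact/inverse_nneg_within/ltW.
  by rewrite in_itv/=; lra.
apply/cvgrPdist_le => e e0.
have /cvgrPdist_le/(_ e e0) [d /= d0 dP] := pc.
near=> k.
have k0 : k != 0 by near: k; exact: nbhs_dnbhs_neq.
have kd : `|k| < d by near: k; exact: dnbhs0_lt.
have ka : `|k| < a by near: k; exact: dnbhs0_lt.
have ak0 : 0 <= k + a by move: ka; rewrite ltr_norml => /andP[]; lra.
have := dP (k + a); rewrite /ball_/= opprD addrCA subrr addr0 normrN => /(_ kd).
rewrite [_%:A]mulr1 /GRing.scale/=.
have := D_ge (ltW a0) ak0; have := D_ge ak0 (ltW a0).
rewrite addrK opprD addrCA subrr addr0.
have [v vE] : exists v, D (k + a) - D a = k * v.
  by exists (k^-1 * (D (k + a) - D a)); rewrite mulVKf.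
rewrite -[D a - _]opprB vE mulKf// mulNr lerN2 => H1 H2.
rewrite !ler_norml => /andP[? ?]; move: H1 H2.
move: k0; rewrite neq_lt => /orP[k0|k0].
  by rewrite !ler_nM2l// => *; lra.
by rewrite !ler_pM2l// => *; lra.
Unshelve. all: by end_near. Qed.

(** Fundamental theorem of calculus for the antiderivative [D] of [p]. Continuity at the endpoints 0
    and [a] comes from the Lipschitz bound. *)
Let legendre_fenchelE a : 0 <= a -> legendre_fenchel dgamma a = D a.
Proof.
have [_ _ _ g0] := gamma_K.
have D0 : D 0 = 0 by rewrite /D inverse_nneg0 g0 mul0r subrr.
rewrite le_eqVlt => /predU1P[<-|a0].
  by rewrite /legendre_fenchel set_itv1 Rintegral_set1 D0.
rewrite /legendre_fenchel /Rintegral (@continuous_FTC2 _ _ D)//=.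
- by rewrite D0 subr0.
- exact: inverse_nneg_within (ltW a0).
- have Dc x : 0 <= x <= a -> forall e, 0 < e ->
      \forall y \near x, 0 <= y <= a -> `|D x - D y| <= e.
    move=> xa e e0.
    have pa0 : 0 < p a + 1 by rewrite ltr_wpDl// inverse_nneg_ge0// ltW.
    exists (e / (p a + 1)); first by rewrite /= divr_gt0.
    move=> y /=; rewrite ltr_pdivlMr// => xy ya.
    apply: le_trans (D_lip xa ya) _; apply: le_trans (ltW xy).
    by rewrite mulrC ler_wpM2l// lerDl.
  split.
  + by move=> x; rewrite in_itv/= => /andP[x0 _]; have [] := D_derive x0.
  + apply/cvgrPdist_le => e e0; near=> x.
    have x0 : 0 < x by near: x; exact: nbhs_right_gt.
    have xa : x <= a by near: x; exact: nbhs_right_le.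
    have : 0 <= x <= a by rewrite xa ltW.
    near: x; apply: cvg_at_right_filter (@cvg_id _ _) _ (Dc 0 _ _ e0).
    by rewrite lexx ltW.
  + apply/cvgrPdist_le => e e0; near=> x.
    have x0 : 0 <= x by near: x; exact: nbhs_left_ge.
    have xa : x < a by near: x; exact: nbhs_left_lt.
    have : 0 <= x <= a by rewrite x0 ltW.
    near: x; apply: cvg_at_left_filter (@cvg_id _ _) _ (Dc a _ _ e0).
    by rewrite lexx ltW.
- move=> x; rewrite in_itv/= => /andP[x0 _]; rewrite derive1E.
  by have [] := D_derive x0.
Unshelve. all: by end_near. Qed.

Lemma legendre_fenchel_young a b : 0 <= a -> 0 <= b ->
  a * b <= legendre_fenchel dgamma a + gamma b.
Proof. by move=> a0 b0; rewrite legendre_fenchelE//; exact: D_young. Qed.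

Lemma legendre_fenchel_youngE a : 0 <= a ->
  legendre_fenchel dgamma a + gamma (p a) = a * p a.
Proof. by move=> a0; rewrite legendre_fenchelE// /D subrK. Qed.

Lemma legendre_fenchel_ge0 a : 0 <= a -> 0 <= legendre_fenchel dgamma a.
Proof.
have [_ _ _ g0] := gamma_K.
move=> a0; have := legendre_fenchel_young a0 (lexx 0).
by rewrite mulr0 g0 addr0.
Qed.

End legendre_fenchel.

(** * Euclidean norm and quadratic forms *)

Section quadratic_forms.
Context {R : realType}.

Lemma enorm_ge0 m p (v : 'M[R]_(m, p)) : 0 <= enorm v.
Proof. exact: sqrtr_ge0. Qed.

Lemma enorm_sqr m p (v : 'M[R]_(m, p)) :
  enorm v ^+ 2 = \sum_i \sum_j v i j ^+ 2.
Proof.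
rewrite sqr_sqrtr// sumr_ge0// => i _.
by rewrite sumr_ge0// => j _; exact: sqr_ge0.
Qed.

Lemma enorm_trmx m p (v : 'M[R]_(m, p)) : enorm v^T = enorm v.
Proof.
rewrite /enorm exchange_big; congr Num.sqrt.
by apply: eq_bigr => i _; apply: eq_bigr => j _; rewrite mxE.
Qed.

Lemma enorm_scale m p (c : R) (v : 'M[R]_(m, p)) :
  enorm (c *: v) = `|c| * enorm v.
Proof.
rewrite /enorm -sqrtr_sqr -sqrtrM ?sqr_ge0// mulr_sumr; congr Num.sqrt.
apply: eq_bigr => i _; rewrite mulr_sumr.
by apply: eq_bigr => j _; rewrite mxE exprMn.
Qed.

Lemma enorm_eq0 m p (v : 'M[R]_(m, p)) : enorm v == 0 -> v = 0.
Proof.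
rewrite -sqrf_eq0 enorm_sqr => v0; apply/matrixP => i j; rewrite mxE.
have vi k : true -> 0 <= \sum_j v k j ^+ 2.
  by move=> _; rewrite sumr_ge0// => ? _; exact: sqr_ge0.
have := v0; rewrite psumr_eq0// => /allP/(_ i).
rewrite mem_index_enum => /(_ isT).
rewrite psumr_eq0; last by move=> ? _; exact: sqr_ge0.
move=> /allP/(_ j); rewrite mem_index_enum => /(_ isT).
by rewrite /= sqrf_eq0 => /eqP.
Qed.

Lemma enorm_mulmx_trmx m (l : 'rV[R]_m) : (l *m l^T) 0 0 = enorm l ^+ 2.
Proof.
by rewrite enorm_sqr big_ord1 mxE; apply: eq_bigr => j _; rewrite mxE -expr2.
Qed.

(** With [a = |l|], [b = |d|] and [q = l d], the squared norm of [b l + a d^T] is [2 a b (a b + q)].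
    If [a b = 0], one of the vectors vanishes. *)
Lemma cauchy_schwarz m (l : 'rV[R]_m) (d : 'cV[R]_m) :
  - (enorm l * enorm d) <= (l *m d) 0 0.
Proof.
set a := enorm l; set b := enorm d.
have a0 : 0 <= a by exact: enorm_ge0.
have b0 : 0 <= b by exact: enorm_ge0.
have E : (b *: l + a *: d^T) *m (b *: l + a *: d^T)^T =
    (b ^+ 2 *: (l *m l^T) + (a * b) *: (l *m d) + (a * b) *: (l *m d)^T +
      a ^+ 2 *: (d^T *m d^T^T)).
  rewrite linearD/= !linearZ/= trmxK mulmxDl !mulmxDr -!scalemxAl -!scalemxAr.
  by rewrite !scalerA trmx_mul !expr2 !addrA [b * a]mulrC.
have := sqr_ge0 (enorm (b *: l + a *: d^T)); rewrite -enorm_mulmx_trmx E.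
rewrite -trace_mx11 !mxtraceD !mxtraceZ mxtrace_tr !trace_mx11.
rewrite !enorm_mulmx_trmx enorm_trmx -/a -/b.
set q := (l *m d) 0 0 => H.
have [ab0|ab0] := ltP 0 (a * b).
  have : 0 <= (a * b) * (2 * (a * b + q)) by apply: le_trans H _; lra.
  by rewrite pmulr_rge0//; lra.
have {ab0 H} : a * b = 0 by apply/eqP; rewrite eq_le ab0 mulr_ge0.
move=> ab0; rewrite ab0 oppr0; move/eqP: ab0.
rewrite mulf_eq0 => /orP[] /enorm_eq0 v0.
  by rewrite /q v0 mul0mx mxE.
by rewrite /q v0 mulmx0 mxE.
Qed.

Lemma sym_posdef_unitmx m (M : 'M[R]_m) : sym_posdef M -> M \in unitmx.
Proof.
move=> [Ms Mp]; rewrite -row_free_unit; apply/inj_row_free => v vM.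
apply/eqP/negP => /negP v0.
have := Mp v^T; rewrite /qform trmxK vM mul0mx mxE ltxx.
by rewrite -(inj_eq trmx_inj) trmx0 trmxK => /(_ v0).
Qed.

Lemma qform_ge0 m (M : 'M[R]_m) (v : 'cV[R]_m) : sym_posdef M -> 0 <= qform M v.
Proof.
move=> [_ Mp]; have [->|/Mp/ltW//] := eqVneq v 0.
by rewrite /qform mulmx0 mxE.
Qed.

(** With [w = invmx M *m l^T], symmetry of [M] gives [w^T M = l], so both cross terms equal [c]
    times [l v]. *)
Lemma qform_complete_square m (M : 'M[R]_m) (l : 'rV[R]_m) (v : 'cV[R]_m)
    (c : R) :
  sym_posdef M ->
  qform M (v - c *: (invmx M *m l^T)) =
  qform M v - 2 * c * (l *m v) 0 0 + c ^+ 2 * qform (invmx M) l^T.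
Proof.
move=> Mpos; have Mu := sym_posdef_unitmx Mpos; have [Ms _] := Mpos.
set w := invmx M *m l^T.
have Mw : M *m w = l^T by rewrite mulKVmx.
have wM : w^T *m M = l by have := congr1 trmx Mw; rewrite trmx_mul trmxK Ms.
have -> : qform (invmx M) l^T = (l *m w) 0 0 by rewrite /qform trmxK mulmxA.
have vl : (v^T *m l^T) 0 0 = (l *m v) 0 0 by rewrite -trmx_mul mxE.
rewrite /qform [(_ - _)^T]linearB/= [(_ *: _)^T]linearZ/=.
rewrite !mulmxBl !mulmxBr -!scalemxAl -!scalemxAr.
rewrite wM -(mulmxA v^T M w) Mw -!trace_mx11 !raddfB/= !mxtraceZ.
rewrite !trace_mx11 vl; ring.
Qed.

(** By symmetry this is the form of [M] evaluated at [invmx M *m v]. *)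
Lemma qform_invmx_ge0 m (M : 'M[R]_m) (v : 'cV[R]_m) : sym_posdef M ->
  0 <= qform (invmx M) v.
Proof.
move=> Mpos; have Mu := sym_posdef_unitmx Mpos; have [Ms _] := Mpos.
have -> : qform (invmx M) v = qform M (invmx M *m v).
  by rewrite /qform -[in RHS]mulmxA mulKVmx// trmx_mul trmx_inv Ms.
exact: qform_ge0.
Qed.

End quadratic_forms.

(** * Inverse optimality *)

(** The sign of [c] is free: [2 * beta] serves the upper bound on the cost and [- (2 * beta)] the
    lower one. *)
Lemma solution_scale_le (R : realType) n (h : 'cV[R]_n -> R)
    (F : 'cV[R]_n -> R -> 'cV[R]_n) (x0 : 'cV[R]_n) (x : R -> 'cV[R]_n)
    (c : R) (g : R -> R) (T : R) :
  (forall y, differentiable h y) -> is_solution F x0 x -> 0 <= T ->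
  lebesgue_measure.-integrable `[0, T] (EFin \o g) ->
  (forall t, 0 <= t -> c * 'd h (x t) (F (x t) t) <= g t) ->
  c * h (x T) <= c * h x0 + \int[lebesgue_measure]_(s in `[0, T]) g s.
Proof.
move=> dh sol T0 gi hg; apply: (@solution_le _ _ (c *: h) F) => //.
  by move=> y; exact: differentiableZ.
by move=> t t0; rewrite diffZ//; exact: hg.
Qed.

Lemma lieM (R : realType) n m (h : 'cV[R]_n -> R) (G : 'cV[R]_n -> 'M[R]_(n, m))
    (x : 'cV[R]_n) (v : 'cV[R]_m) :
  'd h x (G x *m v) = (lie_mx h G x *m v) 0 0.
Proof.
have -> : G x *m v = \sum_j v j 0 *: col j (G x).
  apply/colP => i; rewrite mxE summxE.
  by apply: eq_bigr => j _; rewrite !mxE mulrC.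
rewrite linear_sum mxE; apply: eq_bigr => j _.
by rewrite linearZ /= mxE mulrC.
Qed.

Section inverse_optimality.
Context {R : realType} {n m1 m2 : nat}.
Notation mu := (@lebesgue_measure R).
Variables (f : 'cV[R]_n -> 'cV[R]_n) (g1 : 'cV[R]_n -> 'M[R]_(n, m1))
  (g2 : 'cV[R]_n -> 'M[R]_(n, m2)) (h : 'cV[R]_n -> R).
Variables (gamma dgamma : R -> R).
Variables (u0 : 'cV[R]_n -> R -> 'cV[R]_m2)
  (R2 : 'cV[R]_n -> 'cV[R]_m2 -> 'M[R]_m2) (beta lambda : R).
Hypothesis h_diff : forall x, differentiable h x.
Hypotheses (gamma_K : class_Kinfty gamma)
  (gamma_dgamma : is_derivative_nneg gamma dgamma)
  (dgamma_K : class_Kinfty dgamma).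
Hypothesis R2_pos : forall x t, 0 <= t -> sym_posdef (R2 x (u0 x t)).
Hypothesis lambda_gt0 : 0 < lambda.

Local Notation sys v d := (system f g1 g2 d (fun y s => u0 y s + v y s)).
Local Notation cost_rate :=
  (integrand f g1 g2 h gamma dgamma u0 R2 beta lambda).

(** Collects the terms of the total rate in [lf_g1] and in the disturbance, divided by [beta]. *)
Definition disturbance_gap (x : 'cV[R]_n) (d : 'cV[R]_m1) : R :=
  lambda * (lf_g1 g1 h dgamma x + gamma (enorm d / lambda)) +
  2 * (lie_mx h g1 x *m d) 0 0.

(** The drift cancels against [running_cost]. The coefficients of [lie_g2_sq] add up to
    [- beta ^+ 2], which completes the square around the optimal deviation. *)
Lemma total_rateE v d (x : R -> 'cV[R]_n) t : 0 <= t ->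
  2 * beta * 'd h (x t) (sys v d (x t) t) + cost_rate v d x t =
  beta * disturbance_gap (x t) (d (x t) t) -
  qform (R2 (x t) (u0 (x t) t))
    (v (x t) t - optimal_deviation g2 h u0 R2 beta (x t) t).
Proof.
move=> t0; rewrite /integrand /running_cost /aux_rate /system /lie.
rewrite mulmxDr !linearD/= !lieM.
rewrite /optimal_deviation /ubar (qform_complete_square _ _ _ (R2_pos _ t0)).
rewrite /disturbance_gap /lie_g2_sq; ring.
Qed.

(** Young at [2 |L|] and [|d| / lambda], scaled by [lambda], gives [2 |L| |d|]; Cauchy-Schwarz
    bounds the linear term below by its opposite. *)
Lemma disturbance_gap_ge0 x d : 0 <= disturbance_gap x d.
Proof.
rewrite /disturbance_gap /lf_g1; set L := lie_mx h g1 x.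
have a0 : 0 <= 2 * enorm L by rewrite mulr_ge0 ?enorm_ge0.
have b0 : 0 <= enorm d / lambda by rewrite divr_ge0 ?enorm_ge0// ltW.
have := legendre_fenchel_young gamma_K gamma_dgamma dgamma_K a0 b0.
rewrite -(ler_pM2l lambda_gt0).
rewrite (_ : lambda * (2 * enorm L * _) = 2 * (enorm L * enorm d)); last first.
  by field; rewrite gt_eqF.
have := cauchy_schwarz L d; lra.
Qed.

(** Equality in both inequalities: the direction is opposite to [L^T], and the norm divided by
    [lambda] is [p]. *)
Lemma disturbance_gap_worst x t :
  disturbance_gap x (worst_disturbance g1 h dgamma lambda x t) = 0.
Proof.
rewrite /disturbance_gap /worst_disturbance /lf_g1; set L := lie_mx h g1 x.
set p := inverse_nneg dgamma (2 * enorm L).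
have a0 : 0 <= 2 * enorm L by rewrite mulr_ge0 ?enorm_ge0.
have p0 : 0 <= p by exact: inverse_nneg_ge0.
have -> : enorm (- (lambda * p / enorm L) *: L^T) = lambda * p.
  rewrite enorm_scale enorm_trmx normrN ger0_norm; last first.
    by rewrite divr_ge0 ?enorm_ge0// mulr_ge0// ltW.
  (* For [L = 0] both sides vanish, since [p] is then the inverse at 0. *)
  have [L0|L0] := eqVneq (enorm L) 0; last by rewrite divfK.
  by rewrite L0 mulr0 /p L0 mulr0 inverse_nneg0// mulr0.
rewrite [lambda * p / lambda]mulrAC divff ?gt_eqF// mul1r.
rewrite (legendre_fenchel_youngE gamma_K gamma_dgamma dgamma_K a0) -/p.
rewrite -scalemxAr mxE enorm_mulmx_trmx.
have [L0|L0] := eqVneq (enorm L) 0; first by rewrite L0; ring.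
by field.
Qed.

Lemma lim_cost_upto_le x0 v d x :
  well_posed f g1 g2 h gamma dgamma u0 R2 beta lambda x0 v d x ->
  (forall t, 0 <= t ->
     2 * beta * 'd h (x t) (sys v d (x t) t) + cost_rate v d x t <= 0) ->
  (lim (cost_upto f g1 g2 h gamma dgamma u0 R2 beta lambda v d x t
        @[t --> +oo%R])
   <= (2 * beta * h x0)%:E)%E.
Proof.
move=> [sol Ii cv] H; apply: lime_le => //; near=> t.
have t0 : 0 <= t by near: t; exact: nbhs_pinfty_ge.
have Ni : mu.-integrable `[0, t] (EFin \o (fun s => - 1 * cost_rate v d x s)).
  have -> : EFin \o (fun s => - 1 * cost_rate v d x s) =
      (fun s => (-1)%:E * (cost_rate v d x s)%:E)%E.
    by apply/funext => s; rewrite /= -EFinM.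
  by apply: integrableZl => //; exact: Ii.
have := @solution_scale_le _ _ _ _ _ _ (2 * beta) _ _ h_diff sol t0 Ni.
rewrite RintegralZl//; last exact: Ii.
rewrite /cost_upto lee_fin; set I := Rintegral _ _ _.
move=> K; suff : 2 * beta * h (x t) <= 2 * beta * h x0 + -1 * I by lra.
apply: K => s s0; have := H _ s0; lra.
Unshelve. all: by end_near. Qed.

Lemma lim_cost_upto_ge x0 v d x :
  well_posed f g1 g2 h gamma dgamma u0 R2 beta lambda x0 v d x ->
  (forall t, 0 <= t ->
     0 <= 2 * beta * 'd h (x t) (sys v d (x t) t) + cost_rate v d x t) ->
  ((2 * beta * h x0)%:E <=
   lim (cost_upto f g1 g2 h gamma dgamma u0 R2 beta lambda v d x t
        @[t --> +oo%R]))%E.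
Proof.
move=> [sol Ii cv] H; apply: lime_ge => //; near=> t.
have t0 : 0 <= t by near: t; exact: nbhs_pinfty_ge.
have := @solution_scale_le _ _ _ _ _ _ (- (2 * beta)) _ _ h_diff sol t0
  (Ii t t0).
rewrite /cost_upto lee_fin; set I := Rintegral _ _ _.
move=> K; suff : - (2 * beta) * h (x t) <= - (2 * beta) * h x0 + I by lra.
apply: K => s s0; have := H _ s0; lra.
Unshelve. all: by end_near. Qed.

End inverse_optimality.

Theorem theorem4 (R : realType) (n m1 m2 : nat)
  (f : 'cV[R]_n -> 'cV[R]_n)
  (g1 : 'cV[R]_n -> 'M[R]_(n, m1))
  (g2 : 'cV[R]_n -> 'M[R]_(n, m2))
  (f_lip : [locally [lipschitz f x | x in setT]])
  (g1_lip : [locally [lipschitz g1 x | x in setT]])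
  (g2_lip : [locally [lipschitz g2 x | x in setT]])
  (u0 : 'cV[R]_n -> R -> 'cV[R]_m2)
  (h : 'cV[R]_n -> R)
  (h_barrier : barrier_candidate h)
  (h_safe : isolated (safe_set h) = set0)
  (gamma dgamma : R -> R)
  (gamma_K : class_Kinfty gamma)
  (gamma_dgamma : is_derivative_nneg gamma dgamma)
  (dgamma_K : class_Kinfty dgamma)
  (R2 : 'cV[R]_n -> 'cV[R]_m2 -> 'M[R]_m2)
  (R2_pos : forall x t, 0 <= t -> sym_posdef (R2 x (u0 x t)))
  (alpha : R -> R)
  (alpha_K : class_Kh h alpha)
  (aux_safe : forall x t, 0 <= t ->
    aux_rate f g1 g2 h dgamma R2 x (u0 x t) >= - alpha (h x))
  (beta : R) (beta_ge2 : 2 <= beta)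
  (lambda : R) (lambda_gt0 : 0 < lambda) (lambda_le2 : lambda <= 2) :
  (forall (U : set ('cV[R]_n -> R -> 'cV[R]_m2))
     (D : set ('cV[R]_n -> R -> 'cV[R]_m1))
     (x0 : 'cV[R]_n)
     (sol : ('cV[R]_n -> R -> 'cV[R]_m2) -> ('cV[R]_n -> R -> 'cV[R]_m1) ->
            R -> 'cV[R]_n),
     (forall v, U v -> locally_bounded_feedback v) ->
     (forall d, D d -> locally_bounded_feedback d) ->
     U (optimal_deviation g2 h u0 R2 beta) ->
     D (worst_disturbance g1 h dgamma lambda) ->
     (forall v d, U v -> D d ->
        well_posed f g1 g2 h gamma dgamma u0 R2 beta lambda x0 v d
          (sol v d)) ->
     forall v, U v ->
       (cost f g1 g2 h gamma dgamma u0 R2 beta lambda D sol v <=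
        cost f g1 g2 h gamma dgamma u0 R2 beta lambda D sol
          (optimal_deviation g2 h u0 R2 beta))%E) /\
  (forall x t, 0 <= t ->
     running_cost f g1 g2 h dgamma R2 beta lambda x (u0 x t)
     <= 2 * beta * alpha (h x)).
Proof.
have h_diff := h_barrier.1.
have beta0 : 0 <= beta by lra.
split.
- move=> U D x0 sol _ _ Uopt Dworst wp v Uv.
  (* This value separates the two costs, and it depends neither on [v] nor on [d]. *)
  apply: (@le_trans _ _ (2 * beta * h x0)%:E).
    apply: le_trans.
      apply: ereal_inf_lbound.
      by exists (worst_disturbance g1 h dgamma lambda).
    apply: lim_cost_upto_le => //; first exact: wp.
    move=> t t0; rewrite total_rateE// disturbance_gap_worst//.
    rewrite mulr0 sub0r oppr_le0.
    exact/qform_ge0/R2_pos.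
  apply: le_ereal_inf_tmp => _ [d Dd <-].
  apply: lim_cost_upto_ge => //; first exact: wp.
  move=> t t0; rewrite total_rateE// subrr /qform mulmx0 mxE subr0.
  by rewrite mulr_ge0// disturbance_gap_ge0.
- move=> x t t0; rewrite /running_cost.
  have := aux_safe x t t0.
  have : 0 <= lie_g2_sq g2 h R2 x (u0 x t) by exact/qform_invmx_ge0/R2_pos.
  have : 0 <= lf_g1 g1 h dgamma x.
    by apply: (legendre_fenchel_ge0 gamma_K) => //; rewrite mulr_ge0 ?enorm_ge0.
  set l := lf_g1 _ _ _ _; set q := lie_g2_sq _ _ _ _ _.
  set a := aux_rate _ _ _ _ _ _ _ _.
  move=> l0 q0 aa.
  (* The slack in the bound is the sum of this term, the next one and twice the third; [lambda <= 2]
     and [2 <= beta] give the signs of the first two. *)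
  have : 0 <= beta * (2 - lambda) * l by rewrite mulr_ge0 ?mulr_ge0//; lra.
  have : 0 <= beta * (beta - 2) * q by rewrite mulr_ge0 ?mulr_ge0//; lra.
  have : 0 <= beta * (a + alpha (h x)) by rewrite mulr_ge0//; lra.
  lra.
Qed.
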